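(* Let $f=[g:g_1,\dots,g_s;h_1,\dots,h_r]$ be a differentiable convertible nonconvex function and let $(\boldsymbol{x}^*,\boldsymbol{y}^* )\in X(g)$. Then there is an optimal solution $\boldsymbol{d}^*$ to the linear program $\mathrm{(CNP0)}(\boldsymbol{x}^*,\boldsymbol{y}^* )$ such that $\nabla g(\boldsymbol{x}^*,\boldsymbol{y}^* )^\top\boldsymbol{d}^*\ge 0$ if and only if there are $\boldsymbol{u}^*=(u_1^*,\dots,u_s^* )^\top\ge 0$ and $\boldsymbol{v}^*=(v_1^*,\dots,v_r^* )^\top\in R^r$ such that $$\nabla g(\boldsymbol{x}^*,\boldsymbol{y}^* )+\sum_{i=1}^s u_i^*\nabla g_i(\boldsymbol{x}^*,\boldsymbol{y}^* )+\sum_{j=1}^r v_j^*\nabla h_j(\boldsymbol{x}^*,\boldsymbol{y}^* )=0,\qquad u_i^*g_i(\boldsymbol{x}^*,\boldsymbol{y}^* )=0\ \ (i=1,\dots,s).$$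
   Context: Let $f:R^n\to R$ be nonconvex or nonsmooth and let $g,g_i,h_j:R^n\times R^m\to R$ ($i=1,\dots,s$; $j=1,\dots,r$) be convex. Put $X(f)=\{(\boldsymbol{x},\boldsymbol{y}): g_i(\boldsymbol{x},\boldsymbol{y})\le 0\ (i=1,\dots,s),\ h_j(\boldsymbol{x},\boldsymbol{y})=0\ (j=1,\dots,r)\}$, $X(f(\boldsymbol{x}))=\{\boldsymbol{y}\in R^m: (\boldsymbol{x},\boldsymbol{y})\in X(f)\}$ for fixed $\boldsymbol{x}$, and $X(g)=\{(\boldsymbol{x},\boldsymbol{y})\in X(f): g(\boldsymbol{x},\boldsymbol{y})=f(\boldsymbol{x})\}$. The function $f$ is a convertible nonconvex function, written $f=[g:g_1,\dots,g_s;h_1,\dots,h_r]$, if for each $\boldsymbol{x}\in R^n$ there is $\bar{\boldsymbol{y}}\in X(f(\boldsymbol{x}))$ with $f(\boldsymbol{x})=g(\boldsymbol{x},\bar{\boldsymbol{y}})$ and $f(\boldsymbol{x})=\min_{\boldsymbol{y}\in X(f(\boldsymbol{x}))}g(\boldsymbol{x},\boldsymbol{y})$. It is a differentiable convertible nonconvex function if moreover all of $g,g_i,h_j$ are differentiable (with $s>0$); $f$ itself need not be differentiable or convex. Gradients are with respect to $(\boldsymbol{x},\boldsymbol{y})$. For fixed $(\boldsymbol{x},\boldsymbol{y})$, $\mathrm{(CNP0)}(\boldsymbol{x},\boldsymbol{y})$ is the linear program in $\boldsymbol{d}\in R^n\times R^m$: minimize $\nabla g(\boldsymbol{x},\boldsymbol{y})^\top\boldsymbol{d}$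 subject to $g_i(\boldsymbol{x},\boldsymbol{y})+\nabla g_i(\boldsymbol{x},\boldsymbol{y})^\top\boldsymbol{d}\le 0$ ($i=1,\dots,s$) and $\nabla h_j(\boldsymbol{x},\boldsymbol{y})^\top\boldsymbol{d}=0$ ($j=1,\dots,r$). *)

(* Defs.v *)
From HB Require Import structures.
From mathcomp Require Import all_boot all_order all_algebra.
From mathcomp Require Import all_classical all_reals all_analysis.

Set Implicit Arguments.
Unset Strict Implicit.
Unset Printing Implicit Defensive.
Import Order.TTheory GRing.Theory Num.Theory.
Import numFieldNormedType.Exports.

Local Open Scope classical_set_scope.
Local Open Scope ring_scope.

(* The space R^n x R^m is the product normed module
   'rV[R]_n * 'rV[R]_m; its norm is the maximum of the sup norms, so that
   differentiability is the usual one. *)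

Definition convex_on_space (R : realType) (E : lmodType R) (f : E -> R) : Prop :=
  convex_function [set: convex_lmodType E] f.

Definition differentiable_everywhere (R : realType) (V : normedModType R)
    (f : V -> R) : Prop :=
  forall z : V, differentiable (f : V -> R^o) z.

Definition dotp (R : realType) (n m : nat) (p q : 'rV[R]_n * 'rV[R]_m) : R :=
  \sum_(i < n) p.1 0 i * q.1 0 i + \sum_(j < m) p.2 0 j * q.2 0 j.

(* The vector of all first partial derivatives, those in x being listed in the
   first component and those in y in the second. *)
Definition gradient (R : realType) (n m : nat)
    (phi : 'rV[R]_n * 'rV[R]_m -> R) (z : 'rV[R]_n * 'rV[R]_m) :
    'rV[R]_n * 'rV[R]_m :=
  (\row_i ('D_(delta_mx 0 i, 0) (phi : _ -> R^o) z),
   \row_j ('D_(0, delta_mx 0 j) (phi : _ -> R^o) z)).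

Definition is_minimum (R : realType) (S : set R) (v : R) : Prop :=
  S v /\ lbound S v.

(* Xset, Xfiber _ _ x and Xgraph are written X(f), X(f(x)) and X(g) on paper,
   although the first two depend only on the representing g_i and h_j. *)
Definition Xset (R : realType) (n m s r : nat)
    (gi : 'I_s -> 'rV[R]_n * 'rV[R]_m -> R)
    (hj : 'I_r -> 'rV[R]_n * 'rV[R]_m -> R) : set ('rV[R]_n * 'rV[R]_m) :=
  [set z | (forall i, gi i z <= 0) /\ (forall j, hj j z = 0)].

Definition Xfiber (R : realType) (n m s r : nat)
    (gi : 'I_s -> 'rV[R]_n * 'rV[R]_m -> R)
    (hj : 'I_r -> 'rV[R]_n * 'rV[R]_m -> R) (x : 'rV[R]_n) : set 'rV[R]_m :=
  [set y | Xset gi hj (x, y)].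

Definition Xgraph (R : realType) (n m s r : nat) (f : 'rV[R]_n -> R)
    (g : 'rV[R]_n * 'rV[R]_m -> R)
    (gi : 'I_s -> 'rV[R]_n * 'rV[R]_m -> R)
    (hj : 'I_r -> 'rV[R]_n * 'rV[R]_m -> R) : set ('rV[R]_n * 'rV[R]_m) :=
  [set z | Xset gi hj z /\ g z = f z.1].

(* f = [g : g_1, ..., g_s; h_1, ..., h_r]. The first clause is the standing
   assumption that f is nonconvex or nonsmooth. *)
Definition convertible_nonconvex (R : realType) (n m s r : nat)
    (f : 'rV[R]_n -> R) (g : 'rV[R]_n * 'rV[R]_m -> R)
    (gi : 'I_s -> 'rV[R]_n * 'rV[R]_m -> R)
    (hj : 'I_r -> 'rV[R]_n * 'rV[R]_m -> R) : Prop :=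
  [/\ ~ convex_on_space f \/ ~ differentiable_everywhere f,
      convex_on_space g,
      forall i, convex_on_space (gi i),
      forall j, convex_on_space (hj j) &
      forall x : 'rV[R]_n,
        (exists2 ybar, Xfiber gi hj x ybar & f x = g (x, ybar)) /\
        is_minimum [set g (x, y) | y in Xfiber gi hj x] (f x)].

Definition differentiable_convertible_nonconvex (R : realType) (n m s r : nat)
    (f : 'rV[R]_n -> R) (g : 'rV[R]_n * 'rV[R]_m -> R)
    (gi : 'I_s -> 'rV[R]_n * 'rV[R]_m -> R)
    (hj : 'I_r -> 'rV[R]_n * 'rV[R]_m -> R) : Prop :=
  [/\ convertible_nonconvex f g gi hj,
      (0 < s)%N,
      differentiable_everywhere g,
      forall i, differentiable_everywhere (gi i) &
      forall j, differentiable_everywhere (hj j)].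

Definition CNP0_feasible (R : realType) (n m s r : nat)
    (gi : 'I_s -> 'rV[R]_n * 'rV[R]_m -> R)
    (hj : 'I_r -> 'rV[R]_n * 'rV[R]_m -> R)
    (z : 'rV[R]_n * 'rV[R]_m) : set ('rV[R]_n * 'rV[R]_m) :=
  [set d | (forall i, gi i z + dotp (gradient (gi i) z) d <= 0) /\
           (forall j, dotp (gradient (hj j) z) d = 0)].

Definition CNP0_optimal (R : realType) (n m s r : nat)
    (g : 'rV[R]_n * 'rV[R]_m -> R)
    (gi : 'I_s -> 'rV[R]_n * 'rV[R]_m -> R)
    (hj : 'I_r -> 'rV[R]_n * 'rV[R]_m -> R)
    (z d : 'rV[R]_n * 'rV[R]_m) : Prop :=
  CNP0_feasible gi hj z d /\
  forall d', CNP0_feasible gi hj z d' ->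
    dotp (gradient g z) d <= dotp (gradient g z) d'.

(* Main.v *)
Require Import Defs.
From HB Require Import structures.
From mathcomp Require Import all_boot all_order all_algebra.
From mathcomp Require Import all_classical all_reals all_analysis.
From mathcomp Require Import sesquilinear ring.

(** The point z = (xs, ys) lies in X(f), so d = 0 is feasible for the linear program
    and the optimal value is at most 0.  An optimal d with nonnegative value
    therefore exists exactly when the objective [dotp (gradient g z)] is
    nonnegative on the whole feasible set, and then 0 itself is optimal.

    That condition only concerns the cone of directions d with
    [dotp (gradient (gi i) z) d <= 0] for the active constraints i (those with
    [gi i z = 0]) and [dotp (gradient (hj j) z) d = 0] for all j: a short enough
    positive multiple of such a direction also satisfies the inactive
    constraints ([CNP0_feasible_scale]).  Nonnegativity of a linear form on a
    polyhedral cone is, by Farkas' lemma ([farkas_cone]), the existence of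
    multipliers, here vanishing on the inactive constraints, which is
    complementary slackness.  Conversely, pairing the multiplier equation with a
    feasible d and using complementary slackness gives nonnegativity at once.

    Farkas' lemma is proved by an algebraic induction on the number of
    inequalities ([farkas_seq]): it involves neither closedness of cones nor
    separation, and it works over any ordered field and for any nondegenerate
    pairing of two vector spaces. *)

Import Order.TTheory GRing.Theory Num.Theory.
Import numFieldNormedType.Exports.
Local Open Scope classical_set_scope.
Local Open Scope ring_scope.


(** * Farkas' lemma for a bilinear pairing *)

(** Induction on the constraints (Bartl's argument).  If [c] is already
    nonpositive wherever the constraints other than [k] hold, the multiplier of
    [k] is 0.  Otherwise some [d0] satisfies the
    other constraints, makes [c] positive, and can be scaled so that
    [B (a k) d0 = 1].  The projection [d |-> d - B (a k) d *: d0] onto the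
    kernel of [a k] makes the constraint [a k] void; its transpose sends [w] to
    [w - B w d0 *: a k], and the induction hypothesis applies to the transposed
    vectors.  The multiplier of [k] is nonnegative because [B c d0 > 0] while
    [B (a i) d0 <= 0] for the other [i].  Nondegeneracy starts the induction. *)
Lemma farkas_seq (R : realFieldType) (W V : lmodType R)
    (B : {bilinear W -> V -> R | *%R & *%R})
    (B_nondeg : forall w, (forall d, B w d = 0) -> w = 0)
    (I : eqType) (s : seq I) (a : I -> W) (c : W) :
  uniq s ->
  (forall d, (forall i, i \in s -> B (a i) d <= 0) -> B c d <= 0) ->
  exists2 u : I -> R, (forall i, 0 <= u i) & c = \sum_(i <- s) u i *: a i.
Proof.
elim: s a c => [|k s IHs] a c.
  move=> _ c_le0; exists (fun=> 0) => //.
  rewrite big_nil; apply: B_nondeg => d; apply/eqP; rewrite eq_le c_le0 //=.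
  by rewrite -oppr_le0 -linearNr c_le0.
move=> /= /andP[ks us] c_le0.
have sumE (u : I -> R) (t : R) (b : I -> W) :
    \sum_(i <- s) (if i == k then t else u i) *: b i = \sum_(i <- s) u i *: b i.
  apply: eq_big_seq => i i_s.
  by case: ifP => // /eqP ik; rewrite -ik i_s in ks.
have [H|/existsNP[d1 /not_implyP[d1s /negP]]] :=
  pselect (forall d, (forall i, i \in s -> B (a i) d <= 0) -> B c d <= 0).
  have [u u_ge0 cE] := IHs a c us H.
  exists (fun i => if i == k then 0 else u i) => [i|]; first by case: ifP.
  by rewrite big_cons eqxx scale0r add0r sumE.
rewrite -ltNge => cd1_gt0.
have kd1_gt0 : 0 < B (a k) d1.
  rewrite ltNge; apply/negP => kd1; suff : B c d1 <= 0 by rewrite leNgt cd1_gt0.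
  by apply: c_le0 => i; rewrite inE => /predU1P[->//|]; exact: d1s.
pose d0 := (B (a k) d1)^-1 *: d1.
have kd0 : B (a k) d0 = 1 by rewrite linearZr_LR /= mulVf // gt_eqF.
have cd0 : 0 <= B c d0 by rewrite linearZr_LR /= mulr_ge0 ?invr_ge0 ?ltW.
have sd0 i : i \in s -> B (a i) d0 <= 0.
  by move=> /d1s ad1; rewrite linearZr_LR /= mulr_ge0_le0 ?invr_ge0 // ltW.
clearbody d0; pose tr w := w - B w d0 *: a k.
have trE w d : B (tr w) d = B w (d - B (a k) d *: d0).
  by rewrite linearBl linearZl_LR linearBr linearZr_LR /= mulrC.
have trc_le0 d : (forall i, i \in s -> B (tr (a i)) d <= 0) -> B (tr c) d <= 0.
  move=> trs; rewrite trE; apply: c_le0 => i; rewrite inE => /predU1P[->|i_s].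
    by rewrite -trE /tr kd0 scale1r subrr linear0l.
  by rewrite -trE trs.
have [u u_ge0 trcE] := IHs (tr \o a) (tr c) us trc_le0.
pose t := B c d0 - \sum_(i <- s) u i * B (a i) d0.
exists (fun i => if i == k then t else u i) => [i|].
  case: ifP => // _; rewrite subr_ge0 (le_trans _ cd0) // big_seq sumr_le0 //.
  by move=> j /sd0; apply: mulr_ge0_le0.
rewrite big_cons eqxx sumE -[c in LHS](subrK (B c d0 *: a k)) -/(tr c) trcE.
under eq_bigr do rewrite /= /tr scalerBr scalerA.
by rewrite sumrB -scaler_suml scalerBl [LHS]addrC addrA addrAC.
Qed.

(** Each equality [B (e j) d = 0] is a pair of opposite inequalities, whose two
    nonnegative multipliers combine into one of arbitrary sign. *)
Lemma farkas_cone (R : realFieldType) (W V : lmodType R)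
    (B : {bilinear W -> V -> R | *%R & *%R})
    (B_nondeg : forall w, (forall d, B w d = 0) -> w = 0)
    (I J : finType) (P : pred I) (a : I -> W) (e : J -> W) (c : W) :
  (forall d, (forall i, P i -> B (a i) d <= 0) -> (forall j, B (e j) d = 0) ->
     0 <= B c d) ->
  exists (u : I -> R) (v : J -> R),
    [/\ forall i, 0 <= u i,
        c + \sum_i u i *: a i + \sum_j v j *: e j = 0 &
        forall i, ~~ P i -> u i = 0].
Proof.
move=> c_ge0.
pose b (k : I + (J + J)) : W :=
  match k with inl i => a i | inr (inl j) => e j | inr (inr j) => - e j end.
pose Q (k : I + (J + J)) := if k is inl i then P i else true.
have [|d bd|w w_ge0] := @farkas_seq R W V B B_nondeg _
  [seq k <- index_enum _ | Q k] b (- c).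
- by rewrite filter_uniq // index_enum_uniq.
- have {}bd k : Q k -> B (b k) d <= 0.
    by move=> Qk; apply: bd; rewrite mem_filter Qk mem_index_enum.
  rewrite linearNl oppr_le0; apply: c_ge0 => [i Pi|j]; first exact: (bd (inl i)).
  apply/eqP; rewrite eq_le (bd (inr (inl j))) //= -oppr_le0 -linearNl.
  exact: (bd (inr (inr j))).
rewrite big_filter !big_sumType /= => cE.
exists (fun i => if P i then w (inl i) else 0).
exists (fun j => w (inr (inl j)) - w (inr (inr j))).
split=> [i||i /negPf->//]; first by case: ifP.
rewrite -[c in LHS]opprK cE.
have -> : \sum_i (if P i then w (inl i) else 0) *: a i =
          \sum_(i | P i) w (inl i) *: a i.
  by rewrite [RHS]big_mkcond; apply: eq_bigr => i _; case: ifP; rewrite ?scale0r.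
under [\sum_j (_ - _) *: _]eq_bigr do rewrite scalerBl -scalerN.
by rewrite big_split /= -addrA addNr.
Qed.

(** * The Euclidean pairing on the product space *)

Lemma dotp_bilinear (R : realType) (n m : nat) :
  bilinear_for *%R *%R (@dotp R n m).
Proof.
split=> w k p q; rewrite /dotp /= mulrDr !mulr_sumr addrACA -!big_split /=;
  by congr (_ + _); apply: eq_bigr => i _; rewrite !mxE; ring.
Qed.

HB.instance Definition _ (R : realType) (n m : nat) :=
  bilinear_isBilinear.Build R ('rV[R]_n * 'rV[R]_m)%type
    ('rV[R]_n * 'rV[R]_m)%type R *%R *%R (@dotp R n m) (dotp_bilinear R n m).

Lemma dotp_nondegenerate (R : realType) (n m : nat) (w : 'rV[R]_n * 'rV[R]_m) :
  (forall d, dotp w d = 0) -> w = 0.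
Proof.
move=> /(_ w) /eqP; rewrite /dotp paddr_eq0; last 2 first.
- by apply: sumr_ge0 => i _; rewrite -expr2 sqr_ge0.
- by apply: sumr_ge0 => i _; rewrite -expr2 sqr_ge0.
rewrite !psumr_eq0 => [|i _|i _]; rewrite -?expr2 ?sqr_ge0 //.
case: w => x y /= /andP[/allP x0 /allP y0].
congr (_, _); apply/rowP => i; rewrite mxE; apply/eqP.
  by have := x0 i (mem_index_enum i); rewrite /= mulf_eq0 orbb.
by have := y0 i (mem_index_enum i); rewrite /= mulf_eq0 orbb.
Qed.

(** * The linearized program *)

Lemma CNP0_feasible_0 (R : realType) (n m s r : nat)
    (gi : 'I_s -> 'rV[R]_n * 'rV[R]_m -> R)
    (hj : 'I_r -> 'rV[R]_n * 'rV[R]_m -> R) (z : 'rV[R]_n * 'rV[R]_m) :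
  Xset gi hj z -> CNP0_feasible gi hj z 0.
Proof.
by move=> [gz _]; split=> [i|j]; rewrite linear0r ?addr0.
Qed.

(** Dividing [d] by a large enough number keeps every inactive linearized
    constraint satisfied, since [gi i z < 0] leaves room at 0. *)
Lemma CNP0_feasible_scale (R : realType) (n m s r : nat)
    (gi : 'I_s -> 'rV[R]_n * 'rV[R]_m -> R)
    (hj : 'I_r -> 'rV[R]_n * 'rV[R]_m -> R) (z d : 'rV[R]_n * 'rV[R]_m) :
  Xset gi hj z ->
  (forall i, gi i z == 0 -> dotp (gradient (gi i) z) d <= 0) ->
  (forall j, dotp (gradient (hj j) z) d = 0) ->
  exists2 t, 0 < t & CNP0_feasible gi hj z (t *: d).
Proof.
move=> [gz _] gd hd.
pose q i := `|dotp (gradient (gi i) z) d / gi i z|.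
have q_ge0 i : 0 <= q i by exact: normr_ge0.
pose T : R := 1 + \sum_i q i.
have T_gt0 : 0 < T by rewrite ltr_pwDl // sumr_ge0.
exists T^-1; first by rewrite invr_gt0.
split=> [i|j]; rewrite linearZr_LR /=; last by rewrite hd mulr0.
have [gi0|gi0] := boolP (gi i z == 0).
  by rewrite (eqP gi0) add0r mulr_ge0_le0 ?gd // invr_ge0 ltW.
have gi_lt0 : gi i z < 0 by rewrite lt_neqAle gi0 gz.
have qT : q i <= T.
  by rewrite /T (bigD1 i) //= addrCA lerDl addr_ge0 // sumr_ge0.
rewrite -(ler_pM2l T_gt0) mulr0 mulrDr mulrA mulfV ?gt_eqF // mul1r.
rewrite addrC -[T * _]opprK subr_le0 -mulrN (le_trans (ler_norm _)) //.
rewrite -ler_pdivrMr ?oppr_gt0 // (le_trans _ qT) // /q normrM normfV.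
by rewrite (ltr0_norm gi_lt0).
Qed.

(** Since 0 is a feasible point of value 0, the optimal value is at most 0, and
    if the objective is nonnegative on the feasible set then 0 is optimal. *)
Lemma CNP0_optimal_ge0P (R : realType) (n m s r : nat)
    (g : 'rV[R]_n * 'rV[R]_m -> R)
    (gi : 'I_s -> 'rV[R]_n * 'rV[R]_m -> R)
    (hj : 'I_r -> 'rV[R]_n * 'rV[R]_m -> R) (z : 'rV[R]_n * 'rV[R]_m) :
  Xset gi hj z ->
  (exists d, CNP0_optimal g gi hj z d /\ 0 <= dotp (gradient g z) d) <->
  (forall d, CNP0_feasible gi hj z d -> 0 <= dotp (gradient g z) d).
Proof.
move=> Xz; split=> [[d [[_ d_opt] d_ge0]] d' /d_opt|g_ge0].
  exact: le_trans.
exists 0; rewrite linear0r; split=> //; split; first exact: CNP0_feasible_0.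
by move=> d'; rewrite linear0r; exact: g_ge0.
Qed.


Theorem theorem6 (R : realType) (n m s r : nat)
    (f : 'rV[R]_n -> R) (g : 'rV[R]_n * 'rV[R]_m -> R)
    (gi : 'I_s -> 'rV[R]_n * 'rV[R]_m -> R)
    (hj : 'I_r -> 'rV[R]_n * 'rV[R]_m -> R)
    (xs : 'rV[R]_n) (ys : 'rV[R]_m)
    (hf : differentiable_convertible_nonconvex f g gi hj)
    (hxy : Xgraph f g gi hj (xs, ys)) :
  (exists d : 'rV[R]_n * 'rV[R]_m,
      CNP0_optimal g gi hj (xs, ys) d /\
      0 <= dotp (gradient g (xs, ys)) d)
  <->
  (exists (u : 'rV[R]_s) (v : 'rV[R]_r),
      [/\ forall i, 0 <= u 0 i,
          gradient g (xs, ys)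
            + \sum_(i < s) u 0 i *: gradient (gi i) (xs, ys)
            + \sum_(j < r) v 0 j *: gradient (hj j) (xs, ys) = 0 &
          forall i, u 0 i * gi i (xs, ys) = 0]).
Proof.
have [Xz _] := hxy; set z := (xs, ys) in Xz *.
apply: (iff_trans (CNP0_optimal_ge0P _ _ _ _ _ g _ _ _ Xz)); split.
- move=> g_ge0.
  have [d gd hd|u [v [u_ge0 KKT u0]]] := @farkas_cone R _ _ (@dotp R n m)
    (@dotp_nondegenerate R n m) _ _ (fun i => gi i z == 0)
    (fun i => gradient (gi i) z) (fun j => gradient (hj j) z) (gradient g z).
    have [t t_gt0 /g_ge0] := CNP0_feasible_scale _ _ _ _ _ _ _ _ _ Xz gd hd.
    by rewrite linearZr_LR /= pmulr_rge0.
  exists (\row_i u i), (\row_j v j); split=> [i||i].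
  + by rewrite mxE.
  + rewrite -[RHS]KKT; congr (_ + _ + _); apply: eq_bigr => i _; by rewrite mxE.
  + rewrite mxE; have [->|gi0] := eqVneq (gi i z) 0; first by rewrite mulr0.
    by rewrite u0 ?mul0r.
- move=> [u [v [u_ge0 KKT ugi]]] d [gd hd].
  have := congr1 (fun w => dotp w d) KKT.
  rewrite /= linear0l !linearDl !linear_sumlz /=.
  rewrite [X in _ + _ + X]big1 => [|j _]; last by rewrite linearZl_LR /= hd mulr0.
  rewrite addr0 => /eqP; rewrite addr_eq0 => /eqP ->.
  rewrite oppr_ge0 sumr_le0 // => i _; rewrite linearZl_LR /=.
  (* adding [u 0 i * gi i z = 0] gives [u 0 i] times the linearized constraint *)
  by rewrite -[X in X <= _]add0r -[X in X + _](ugi i) -mulrDr mulr_ge0_le0.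
Qed.
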